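(* Let $\mathcal{B}$ be a connected small category. The grading of $\mathcal{B}$ given by its category of fractions $Q_{\mathcal{B}}:\mathcal{B}\to Q\mathcal{B}$ is effective and universal, in the sense that any other effective grading is uniquely a quotient of it: for every effective grading $X:\mathcal{B}\to\mathcal{G}$ there is a unique map of gradings $Z:Q\mathcal{B}\to\mathcal{G}$ from $Q_{\mathcal{B}}$ to $X$, and $Z$ induces an isomorphism of groupoids $Q\mathcal{B}/\operatorname{Ker}(Z)\cong\mathcal{G}$.
   Context: All categories (and groupoids) are small. A category is connected if its underlying undirected graph has one connected component. The set of morphisms from $x$ to $y$ in a category $\mathcal{A}$ is denoted ${}_y\mathcal{A}_x$. Fundamental groupoid: $Q\mathcal{B}$ is the category of fractions obtained from $\mathcal{B}$ by formally inverting all morphisms: a groupoid with the same objects as $\mathcal{B}$, with a canonical functor $Q_{\mathcal{B}}:\mathcal{B}\to Q\mathcal{B}$, the identity on objects, such that any functor $F:\mathcal{B}\to\mathcal{C}$ sending every morphism to an invertible morphism factors uniquely as $F=F'Q_{\mathcal{B}}$. A grading of $\mathcal{B}$ is a functor $X:\mathcal{B}\to\mathcal{G}$ to a groupoid $\mathcal{G}$; $QX:Q\mathcal{B}\to\mathcal{G}$ denotes the unique functor with $(QX)Q_{\mathcal{B}}=X$. The grading $X$ is effective if $\mathcal{G}$ is connected, $X$ is bijective on objects, and $QX$ is full. A map of gradings from $X:\mathcal{B}\to\mathcal{G}$ to $Y:\mathcal{B}\to\mathcal{H}$ is a functor $Z:\mathcal{G}\to\mathcal{H}$ with $ZX=Y$.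 For a functor $F:\mathcal{G}\to\mathcal{H}$ between groupoids that is injective on objects, $\operatorname{Ker}(F)$ is the subcategory of $\mathcal{G}$ with the same objects as $\mathcal{G}$ and with morphisms those $\gamma$ with $F(\gamma)$ an identity; it is a normal, totally disconnected subgroupoid $\mathcal{N}$ of $\mathcal{G}$ (same objects as $\mathcal{G}$, no morphisms between distinct objects, and $\gamma^{-1}({}_y\mathcal{N}_y)\gamma\subseteq{}_x\mathcal{N}_x$ for all $\gamma\in{}_y\mathcal{G}_x$). For such an $\mathcal{N}$ the quotient groupoid $\mathcal{G}/\mathcal{N}$ has the same objects as $\mathcal{G}$ and as morphisms the equivalence classes of morphisms of $\mathcal{G}$ where $f,g\in{}_y\mathcal{G}_x$ are equivalent iff $g=\beta f\alpha$ for some $\beta\in{}_y\mathcal{N}_y$, $\alpha\in{}_x\mathcal{N}_x$. *)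

(* Defs.v *)
From Stdlib Require Import Relations.
From Stdlib Require Import FunctionalExtensionality PropExtensionality.
From Stdlib Require Import ProofIrrelevance ClassicalEpsilon.

Set Implicit Arguments.
Unset Strict Implicit.
Unset Printing Implicit Defensive.

(* [hom x y] is the set of morphisms from x to y, written _yA_x on paper. *)
Record Category := MkCategory {
  ob :> Type;
  hom : ob -> ob -> Type;
  id : forall x, hom x x;
  comp : forall x y z, hom y z -> hom x y -> hom x z;
  comp_id_l : forall x y (f : hom x y), comp (id y) f = f;
  comp_id_r : forall x y (f : hom x y), comp f (id x) = f;
  comp_assoc : forall x y z w (h : hom z w) (g : hom y z) (f : hom x y),
      comp h (comp g f) = comp (comp h g) f
}.

Arguments id {c} x.
Arguments comp {c x y z} g f.

Declare Scope cat_scope.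
Open Scope cat_scope.
Notation "g ∘ f" := (comp g f) (at level 40, left associativity) : cat_scope.

Definition invertible (C : Category) (x y : C) (f : hom x y) : Prop :=
  exists g : hom y x, g ∘ f = id x /\ f ∘ g = id y.

Record Groupoid := MkGroupoid {
  gcat :> Category;
  inv : forall x y : gcat, hom x y -> hom y x;
  inv_l : forall (x y : gcat) (f : hom x y), inv f ∘ f = id x;
  inv_r : forall (x y : gcat) (f : hom x y), f ∘ inv f = id y
}.

Arguments inv {g x y} f.

(* Exactly one connected component; in particular C is non-empty. *)
Definition Connected (C : Category) : Prop :=
  inhabited C /\
  forall x y : C, clos_refl_sym_trans C (fun a b => inhabited (hom a b)) x y.

Record Functor (C D : Category) := MkFunctor {
  fob :> C -> D;
  fmor : forall x y : C, hom x y -> hom (fob x) (fob y);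
  fmor_id : forall x : C, fmor (id x) = id (fob x);
  fmor_comp : forall (x y z : C) (g : hom y z) (f : hom x y),
      fmor (g ∘ f) = fmor g ∘ fmor f
}.

Arguments fmor {C D} _ {x y} _.

Definition fid (C : Category) : Functor C C :=
  @MkFunctor C C (fun x => x) (fun _ _ f => f)
    (fun _ => eq_refl) (fun _ _ _ _ _ => eq_refl).

Definition fcomp (C D E : Category) (G : Functor D E) (F : Functor C D) :
  Functor C E.
Proof.
refine (@MkFunctor C E (fun x => G (F x)) (fun x y f => fmor G (fmor F f)) _ _).
- intros x. rewrite !fmor_id. reflexivity.
- intros x y z g f. rewrite !fmor_comp. reflexivity.
Defined.

Definition Full (C D : Category) (F : Functor C D) : Prop :=
  forall (x y : C) (g : hom (F x) (F y)), exists f : hom x y, fmor F f = g.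

Definition injective_on_objects (C D : Category) (F : Functor C D) : Prop :=
  forall x y : C, F x = F y -> x = y.

Definition surjective_on_objects (C D : Category) (F : Functor C D) : Prop :=
  forall y : D, exists x : C, F x = y.

Definition bijective_on_objects (C D : Category) (F : Functor C D) : Prop :=
  injective_on_objects F /\ surjective_on_objects F.

Definition IsIsomorphism (C D : Category) (F : Functor C D) : Prop :=
  exists G : Functor D C, fcomp G F = fid C /\ fcomp F G = fid D.

(* Arrows with their endpoints: used to compare functors whose object maps
   are only propositionally equal. *)
Definition arr (C : Category) : Type := {x : C & {y : C & hom x y}}.
Definition mkarr (C : Category) (x y : C) (f : hom x y) : arr C :=
  existT _ x (existT _ y f).

Lemma mkarr_inj (C : Category) (x y : C) (f g : hom x y) :
  mkarr f = mkarr g -> f = g.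
Proof.
intros H. apply EqdepTheory.inj_pair2 in H. now apply EqdepTheory.inj_pair2 in H.
Qed.

Lemma functor_ob_eq (C D : Category) (F G : Functor C D) :
  (forall x : C, mkarr (fmor F (id x)) = mkarr (fmor G (id x))) ->
  fob F = fob G.
Proof.
intros H. apply functional_extensionality. intros x.
exact (f_equal (@projT1 _ _) (H x)).
Qed.

Lemma functor_eq (C D : Category) (F G : Functor C D) :
  (forall (x y : C) (f : hom x y), mkarr (fmor F f) = mkarr (fmor G f)) -> F = G.
Proof.
intros H.
assert (e : fob F = fob G) by (apply functor_ob_eq; auto).
destruct F as [F0 F1 F2 F3], G as [G0 G1 G2 G3]; simpl in *. subst G0.
assert (F1 = G1) as ->.
{ do 3 (apply functional_extensionality_dep; intro). now apply mkarr_inj. }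
f_equal; apply proof_irrelevance.
Qed.

(* The quotient of T by an equivalence relation R, as the type of R-classes. *)
Section Quot.
Variables (T : Type) (R : T -> T -> Prop) (eqR : equivalence T R).

Definition quot : Type := {P : T -> Prop | exists a, P = R a}.

Definition cls (a : T) : quot :=
  exist (fun P => exists a, P = R a) (R a) (ex_intro _ a eq_refl).

Definition repr (q : quot) : T :=
  proj1_sig (constructive_indefinite_description _ (proj2_sig q)).

Lemma cls_repr q : cls (repr q) = q.
Proof using Type.
unfold repr, cls. destruct (constructive_indefinite_description _ _) as [a Ha]; simpl.
destruct q as [P HP]; simpl in *. subst P. f_equal. apply proof_irrelevance.
Qed.

Lemma cls_eq a b : R a b -> cls a = cls b.
Proof using eqR.
intros H. unfold cls.
assert (E : R a = R b).
{ apply functional_extensionality. intros c. apply propositional_extensionality.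
  destruct eqR as [r t s]. split; intros Hc; [eapply t; [apply s|]|eapply t]; eauto. }
generalize (ex_intro (fun x => R a = R x) a eq_refl).
rewrite E. intros p. f_equal. apply proof_irrelevance.
Qed.

Lemma cls_inj a b : cls a = cls b -> R a b.
Proof using eqR.
intros H. apply (f_equal (@proj1_sig _ _)) in H. simpl in H.
rewrite H. destruct eqR as [r t s]. apply r.
Qed.

Lemma repr_cls a : R (repr (cls a)) a.
Proof using eqR. apply cls_inj. apply cls_repr. Qed.

End Quot.

(* Formal composites of morphisms of B and formal inverses of morphisms of B. *)
Inductive word (B : Category) : B -> B -> Type :=
| wgen (x y : B) : hom x y -> word x y
| winv (x y : B) : hom x y -> word y x
| wid (x : B) : word x x
| wcomp (x y z : B) : word y z -> word x y -> word x z.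

Arguments wid {B} x.

(* The congruence making formal composition associative and unital, [wgen]
   functorial, and [winv f] a two-sided inverse of [wgen f]. *)
Inductive weq (B : Category) : forall x y : B, word x y -> word x y -> Prop :=
| weq_refl (x y : B) (u : word x y) : weq u u
| weq_sym (x y : B) (u v : word x y) : weq u v -> weq v u
| weq_trans (x y : B) (u v w : word x y) : weq u v -> weq v w -> weq u w
| weq_comp (x y z : B) (u u' : word y z) (v v' : word x y) :
    weq u u' -> weq v v' -> weq (wcomp u v) (wcomp u' v')
| weq_id_l (x y : B) (u : word x y) : weq (wcomp (wid y) u) u
| weq_id_r (x y : B) (u : word x y) : weq (wcomp u (wid x)) u
| weq_assoc (x y z t : B) (u : word z t) (v : word y z) (w : word x y) :
    weq (wcomp u (wcomp v w)) (wcomp (wcomp u v) w)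
| weq_gen_id (x : B) : weq (wgen (id x)) (wid x)
| weq_gen_comp (x y z : B) (g : hom y z) (f : hom x y) :
    weq (wgen (g ∘ f)) (wcomp (wgen g) (wgen f))
| weq_inv_l (x y : B) (f : hom x y) : weq (wcomp (winv f) (wgen f)) (wid x)
| weq_inv_r (x y : B) (f : hom x y) : weq (wcomp (wgen f) (winv f)) (wid y).

Lemma weq_equiv (B : Category) (x y : B) : equivalence (word x y) (@weq B x y).
Proof. split; red; [apply weq_refl|apply weq_trans|apply weq_sym]. Qed.

Fixpoint wrev (B : Category) (x y : B) (u : word x y) : word y x :=
  match u with
  | wgen f => winv f
  | winv f => wgen f
  | wid x => wid x
  | wcomp u v => wcomp (wrev v) (wrev u)
  end.

Section Fractions.
Variable B : Category.

Local Notation weq_cls := (cls_eq (@weq_equiv _ _ _)).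

Lemma wrev_l_r (x y : B) (u : word x y) :
  weq (wcomp (wrev u) u) (wid x) /\ weq (wcomp u (wrev u)) (wid y).
Proof.
induction u as [x y f|x y f|x|x y z u [IHu1 IHu2] v [IHv1 IHv2]]; simpl.
- split; [apply weq_inv_l|apply weq_inv_r].
- split; [apply weq_inv_r|apply weq_inv_l].
- split; apply weq_id_l.
- split.
  + eapply weq_trans; [apply weq_sym, weq_assoc|].
    eapply weq_trans; [|exact IHv1].
    apply weq_comp; [apply weq_refl|].
    eapply weq_trans; [apply weq_assoc|].
    eapply weq_trans; [|apply weq_id_l].
    apply weq_comp; [exact IHu1|apply weq_refl].
  + eapply weq_trans; [apply weq_sym, weq_assoc|].
    eapply weq_trans; [|exact IHu2].
    apply weq_comp; [apply weq_refl|].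
    eapply weq_trans; [apply weq_assoc|].
    eapply weq_trans; [|apply weq_id_l].
    apply weq_comp; [exact IHv2|apply weq_refl].
Qed.

Definition qhom (x y : B) : Type := quot (@weq B x y).

Definition qcomp (x y z : B) (g : qhom y z) (f : qhom x y) : qhom x z :=
  cls _ (wcomp (repr g) (repr f)).

Lemma qcomp_cls (x y z : B) (u : word y z) (v : word x y) :
  qcomp (cls _ u) (cls _ v) = cls _ (wcomp u v).
Proof.
apply weq_cls. apply weq_comp; apply (repr_cls (@weq_equiv _ _ _)).
Qed.

Definition Qcat : Category.
Proof.
refine (@MkCategory (ob B) qhom (fun x => cls _ (wid x)) qcomp _ _ _).
- intros x y f. rewrite <- (cls_repr f), qcomp_cls. apply weq_cls, weq_id_l.
- intros x y f. rewrite <- (cls_repr f), qcomp_cls. apply weq_cls, weq_id_r.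
- intros x y z w h g f.
  rewrite <- (cls_repr f), <- (cls_repr g), <- (cls_repr h), !qcomp_cls.
  apply weq_cls, weq_assoc.
Defined.

(* The category of fractions inverting every morphism of B; its defining
   universal property, for functors to arbitrary categories, is [Q_universal]. *)
Definition Q : Groupoid.
Proof.
refine (@MkGroupoid Qcat (fun x y f => cls _ (wrev (repr f))) _ _).
- intros x y f. rewrite <- (cls_repr f) at 2. simpl. rewrite qcomp_cls.
  apply weq_cls, wrev_l_r.
- intros x y f. rewrite <- (cls_repr f) at 1. simpl. rewrite qcomp_cls.
  apply weq_cls, wrev_l_r.
Defined.

Definition toQ : Functor B Q.
Proof.
refine (@MkFunctor B Q (fun x => x) (fun x y f => cls _ (wgen f)) _ _).
- intros x. apply weq_cls, weq_gen_id.
- intros x y z g f. simpl. rewrite qcomp_cls. apply weq_cls, weq_gen_comp.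
Defined.

Section Lift.
Variables (C : Category) (F : Functor B C).
Variable iv : forall x y : B, hom x y -> hom (F y) (F x).
Hypothesis iv_l : forall (x y : B) (f : hom x y), iv f ∘ fmor F f = id (F x).
Hypothesis iv_r : forall (x y : B) (f : hom x y), fmor F f ∘ iv f = id (F y).

Fixpoint weval (x y : B) (u : word x y) : hom (F x) (F y) :=
  match u with
  | wgen f => fmor F f
  | winv f => iv f
  | wid x => id (F x)
  | wcomp u v => weval u ∘ weval v
  end.

Lemma weval_weq (x y : B) (u v : word x y) : weq u v -> weval u = weval v.
Proof using iv_l iv_r.
induction 1; simpl; try congruence.
- apply comp_id_l.
- apply comp_id_r.
- apply comp_assoc.
- apply fmor_id.
- apply fmor_comp.
Qed.

Lemma weval_repr (x y : B) (u : word x y) :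
  weval (repr (cls (@weq B x y) u)) = weval u.
Proof using iv_l iv_r. apply weval_weq, (repr_cls (@weq_equiv _ _ _)). Qed.

Definition lift : Functor Q C.
Proof using iv_l iv_r.
refine (@MkFunctor Q C (fob F) (fun x y f => weval (repr f)) _ _).
- intros x. apply weval_repr.
- intros x y z g f. apply weval_repr.
Defined.

Lemma lift_toQ : fcomp lift toQ = F.
Proof. apply functor_eq. intros x y f. simpl. now rewrite weval_repr. Qed.

End Lift.

Lemma inverse_unique (C : Category) (x y : C) (f : hom x y) (g h : hom y x) :
  g ∘ f = id x -> f ∘ h = id y -> g = h.
Proof.
intros H1 H2.
rewrite <- (comp_id_r g), <- H2, comp_assoc, H1. apply comp_id_l.
Qed.

Lemma toQ_epi (C : Category) (F G : Functor Q C) :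
  fcomp F toQ = fcomp G toQ -> F = G.
Proof.
intros H.
assert (Hg : forall (x y : B) (f : hom x y),
  mkarr (fmor F (fmor toQ f)) = mkarr (fmor G (fmor toQ f))).
{ intros x y f. exact (f_equal (fun K : Functor B C => mkarr (fmor K f)) H). }
assert (e : fob F = fob G) by exact (f_equal (@fob B C) H).
destruct F as [F0 F1 F2 F3], G as [G0 G1 G2 G3]; simpl in *. subst G0.
assert (Hg' : forall (x y : B) (f : hom x y),
  F1 x y (cls _ (wgen f)) = G1 x y (cls _ (wgen f))).
{ intros. apply mkarr_inj. apply Hg. }
assert (E : forall (x y : B) (u : word x y),
  F1 x y (cls _ u) = G1 x y (cls _ u)).
{ induction u as [x y f|x y f|x|x y z u IHu v IHv].
  - apply Hg'.
  - apply (inverse_unique (f := F1 x y (cls _ (wgen f)))).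
    + rewrite <- F3. simpl. rewrite qcomp_cls, <- F2. f_equal.
      apply weq_cls, weq_inv_l.
    + rewrite Hg', <- G3. simpl. rewrite qcomp_cls, <- G2. f_equal.
      apply weq_cls, weq_inv_r.
  - exact (eq_trans (F2 x) (eq_sym (G2 x))).
  - rewrite <- qcomp_cls. etransitivity; [apply F3|].
    etransitivity; [|symmetry; apply G3]. now rewrite IHu, IHv. }
apply functor_eq. simpl. intros x y f.
rewrite <- (cls_repr f). now rewrite E.
Qed.

Theorem Q_universal (C : Category) (F : Functor B C) :
  (forall (x y : B) (f : hom x y), invertible (fmor F f)) ->
  exists! F' : Functor Q C, fcomp F' toQ = F.
Proof.
intros HF.
pose (iv := fun (x y : B) (f : hom x y) =>
  proj1_sig (constructive_indefinite_description _ (HF x y f))).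
assert (H : forall (x y : B) (f : hom x y),
  iv x y f ∘ fmor F f = id (F x) /\ fmor F f ∘ iv x y f = id (F y)).
{ intros x y f. exact (proj2_sig (constructive_indefinite_description _ (HF x y f))). }
exists (lift (fun x y f => proj1 (H x y f)) (fun x y f => proj2 (H x y f))).
split; [apply lift_toQ|].
intros F' <-. apply toQ_epi. apply lift_toQ.
Qed.

End Fractions.

(* The functor QX induced by a functor X to a groupoid. *)
Definition Qmap (B : Category) (G : Groupoid) (X : Functor B G) : Functor (Q B) G :=
  lift (F := X) (iv := fun x y f => inv (fmor X f))
    (fun x y f => inv_l (fmor X f)) (fun x y f => inv_r (fmor X f)).

Lemma Qmap_toQ (B : Category) (G : Groupoid) (X : Functor B G) :
  fcomp (Qmap X) (toQ B) = X.
Proof. apply lift_toQ. Qed.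

Lemma Qmap_unique (B : Category) (G : Groupoid) (X : Functor B G)
    (Z : Functor (Q B) G) :
  fcomp Z (toQ B) = X -> Z = Qmap X.
Proof. intros H. apply toQ_epi. now rewrite Qmap_toQ. Qed.

Record Grading (B : Category) := MkGrading {
  gr_groupoid : Groupoid;
  gr_functor :> Functor B gr_groupoid
}.

Definition Effective (B : Category) (X : Grading B) : Prop :=
  Connected (gr_groupoid X) /\ bijective_on_objects X /\ Full (Qmap X).

Definition IsGradingMap (B : Category) (X Y : Grading B)
    (Z : Functor (gr_groupoid X) (gr_groupoid Y)) : Prop :=
  fcomp Z X = Y.

Definition Qgrading (B : Category) : Grading B := MkGrading (toQ B).

Record NormalSubgroupoid (G : Groupoid) := MkNormalSubgroupoid {
  nmem : forall x y : G, hom x y -> Prop;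
  nmem_id : forall x : G, nmem (id x);
  nmem_comp : forall (x y z : G) (g : hom y z) (f : hom x y),
      nmem g -> nmem f -> nmem (g ∘ f);
  nmem_inv : forall (x y : G) (f : hom x y), nmem f -> nmem (inv f);
  nmem_totally_disconnected : forall (x y : G) (f : hom x y), nmem f -> x = y;
  nmem_normal : forall (x y : G) (c : hom x y) (n : hom y y),
      nmem n -> nmem (inv c ∘ n ∘ c)
}.

(* A morphism from x to y, where x = y is not known beforehand, which is an
   identity. *)
Inductive is_identity (C : Category) (x : C) : forall y : C, hom x y -> Prop :=
| is_identity_id : is_identity (id x).

Lemma is_identity_eq (C : Category) (x : C) (f : hom x x) :
  is_identity f -> f = id x.
Proof.
intros H.
assert (E : forall (y : C) (g : hom x y), is_identity g -> mkarr g = mkarr (id x)).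
{ intros y g []. reflexivity. }
apply mkarr_inj, E, H.
Qed.

Lemma is_identity_comp (C : Category) (x y z : C) (g : hom y z) (f : hom x y) :
  is_identity g -> is_identity f -> is_identity (g ∘ f).
Proof.
intros Hg Hf. destruct Hf. rewrite comp_id_r. exact Hg.
Qed.

Lemma fmor_inv (G H : Groupoid) (F : Functor G H) (x y : G) (f : hom x y) :
  fmor F (inv f) = inv (fmor F f).
Proof.
apply (inverse_unique (f := fmor F f)).
- rewrite <- fmor_comp, inv_l. apply fmor_id.
- apply inv_r.
Qed.

Definition Ker (G H : Groupoid) (F : Functor G H)
    (F_inj : injective_on_objects F) : NormalSubgroupoid G.
Proof.
refine (@MkNormalSubgroupoid G (fun x y f => is_identity (fmor F f)) _ _ _ _ _).
- intros x. rewrite fmor_id. constructor.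
- intros x y z g f Hg Hf. rewrite fmor_comp. now apply is_identity_comp.
- intros x y f Hf. rewrite fmor_inv.
  destruct Hf. rewrite <- (comp_id_r (inv (id (F x)))), inv_l. constructor.
- intros x y f Hf. apply F_inj. now destruct Hf.
- intros x y c n Hn. rewrite !fmor_comp, fmor_inv.
  rewrite (is_identity_eq Hn), comp_id_r, inv_l. constructor.
Defined.

Section Quotient.
Variables (G : Groupoid) (N : NormalSubgroupoid G).

Definition nequiv (x y : G) (f g : hom x y) : Prop :=
  exists (b : hom y y) (a : hom x x), nmem N b /\ nmem N a /\ g = b ∘ f ∘ a.

Lemma comp_inv_l (x y z : G) (f : hom x y) (g : hom z x) : inv f ∘ (f ∘ g) = g.
Proof using Type. now rewrite comp_assoc, inv_l, comp_id_l. Qed.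

Lemma comp_inv_r (x y z : G) (f : hom x y) (g : hom y z) : g ∘ f ∘ inv f = g.
Proof using Type. now rewrite <- comp_assoc, inv_r, comp_id_r. Qed.

Lemma inv_inv (x y : G) (f : hom x y) : inv (inv f) = f.
Proof using Type. apply (inverse_unique (f := inv f)); [apply inv_l|apply inv_l]. Qed.

Lemma nequiv_equiv (x y : G) : equivalence (hom x y) (@nequiv x y).
Proof using Type.
split; red.
- intros f. exists (id y), (id x).
  rewrite comp_id_l, comp_id_r. auto using nmem_id.
- intros f g h (b & a & Hb & Ha & ->) (b' & a' & Hb' & Ha' & ->).
  exists (b' ∘ b), (a ∘ a'). rewrite !comp_assoc. auto using nmem_comp.
- intros f g (b & a & Hb & Ha & ->). exists (inv b), (inv a).
  rewrite <- !comp_assoc, inv_r, comp_id_r, comp_inv_l.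
  auto using nmem_inv.
Qed.

(* Normality moves the inner factors to the right of the composite. *)
Lemma nequiv_comp (x y z : G) (g g' : hom y z) (f f' : hom x y) :
  nequiv g g' -> nequiv f f' -> nequiv (g ∘ f) (g' ∘ f').
Proof using Type.
intros (b & a & Hb & Ha & ->) (b' & a' & Hb' & Ha' & ->).
exists b, (inv f ∘ (a ∘ b') ∘ f ∘ a'). repeat split.
- exact Hb.
- apply nmem_comp; [|exact Ha']. apply nmem_normal. now apply nmem_comp.
- rewrite !comp_assoc. now rewrite comp_inv_r.
Qed.

Lemma nequiv_inv (x y : G) (f g : hom x y) :
  nequiv f g -> nequiv (inv f) (inv g).
Proof using Type.
intros (b & a & Hb & Ha & ->). exists (inv a), (inv b).
repeat split; try now apply nmem_inv.
apply (inverse_unique (f := b ∘ f ∘ a)); [apply inv_l|].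
rewrite !comp_assoc, comp_inv_r, comp_inv_r. apply inv_r.
Qed.

Local Notation nequiv_cls := (cls_eq (@nequiv_equiv _ _)).

Definition quo_hom (x y : G) : Type := quot (@nequiv x y).

Definition quo_comp (x y z : G) (g : quo_hom y z) (f : quo_hom x y) : quo_hom x z :=
  cls _ (repr g ∘ repr f).

Lemma quo_comp_cls (x y z : G) (g : hom y z) (f : hom x y) :
  quo_comp (cls _ g) (cls _ f) = cls _ (g ∘ f).
Proof using Type.
apply nequiv_cls. apply nequiv_comp; apply (repr_cls (@nequiv_equiv _ _)).
Qed.

Definition quo_cat : Category.
Proof using G N.
refine (@MkCategory (ob G) quo_hom (fun x => cls _ (id x)) quo_comp _ _ _).
- intros x y f. rewrite <- (cls_repr f), quo_comp_cls. f_equal. apply comp_id_l.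
- intros x y f. rewrite <- (cls_repr f), quo_comp_cls. f_equal. apply comp_id_r.
- intros x y z w h g f.
  rewrite <- (cls_repr f), <- (cls_repr g), <- (cls_repr h), !quo_comp_cls.
  f_equal. apply comp_assoc.
Defined.

Definition Quotient : Groupoid.
Proof using G N.
refine (@MkGroupoid quo_cat (fun x y f => cls _ (inv (repr f))) _ _).
- intros x y f. rewrite <- (cls_repr f) at 2. simpl. rewrite quo_comp_cls.
  f_equal. apply inv_l.
- intros x y f. rewrite <- (cls_repr f) at 1. simpl. rewrite quo_comp_cls.
  f_equal. apply inv_r.
Defined.

Definition toQuotient : Functor G Quotient.
Proof using G N.
refine (@MkFunctor G Quotient (fun x => x) (fun x y f => cls _ f) _ _).
- reflexivity.
- intros x y z g f. simpl. now rewrite quo_comp_cls.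
Defined.

End Quotient.

(* Main.v *)
Require Import Defs.
From Stdlib Require Import ClassicalEpsilon.

Set Implicit Arguments.
Unset Strict Implicit.
Unset Printing Implicit Defensive.

(** The functor QX is the only candidate for Z.  It agrees with X on objects and
    is full by effectiveness, hence so is the functor it induces on
    QB / Ker(QX).  That functor is moreover faithful: if two parallel
    morphisms f and g have the same image, then g = (g f^-1) f with g f^-1 in
    the kernel.  A fully faithful functor that is bijective on objects is an
    isomorphism. *)

Definition Faithful (C D : Category) (F : Functor C D) : Prop :=
  forall (x y : C) (f g : hom x y), fmor F f = fmor F g -> f = g.

(** Equality of packed arrows forces equality of endpoints; after substituting these, the claim is
    plain congruence. *)
Lemma mkarr_comp (C : Category) (x y z x' y' z' : C)
    (g : hom y z) (f : hom x y) (g' : hom y' z') (f' : hom x' y') :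
  mkarr g = mkarr g' -> mkarr f = mkarr f' -> mkarr (g ∘ f) = mkarr (g' ∘ f').
Proof.
intros Hg Hf.
assert (ex : x = x') by exact (f_equal (@projT1 _ _) Hf).
assert (ey : y = y') by exact (f_equal (@projT1 _ _) Hg).
assert (ez : z = z') by exact (f_equal (fun a => projT1 (projT2 a)) Hg).
subst x' y' z'. apply mkarr_inj in Hg, Hf. now subst.
Qed.

(** Injectivity on objects makes the two arrows parallel, and faithfulness then applies. *)
Lemma faithful_mkarr_inj (C D : Category) (F : Functor C D) :
  Faithful F -> injective_on_objects F ->
  forall (x y x' y' : C) (f : hom x y) (f' : hom x' y'),
  mkarr (fmor F f) = mkarr (fmor F f') -> mkarr f = mkarr f'.
Proof.
intros HF Hinj x y x' y' f f' H.
assert (ex : x = x') by exact (Hinj _ _ (f_equal (@projT1 _ _) H)).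
assert (ey : y = y')
  by exact (Hinj _ _ (f_equal (fun a => projT1 (projT2 a)) H)).
subst x' y'. apply mkarr_inj in H. now rewrite (HF _ _ _ _ H).
Qed.

(** Form of fullness for chosen preimages [a], [b] of the endpoints; packing the arrows avoids
    transport along [F a = x] and [F b = y]. *)
Lemma full_mkarr_surj (C D : Category) (F : Functor C D) :
  Full F ->
  forall (a b : C) (x y : D) (g : hom x y), F a = x -> F b = y ->
  exists f : hom a b, mkarr (fmor F f) = mkarr g.
Proof.
intros HF a b x y g <- <-. destruct (HF a b g) as [f <-]. now exists f.
Qed.

(** The inverse chooses preimages of objects and of morphisms. Its functor laws hold because they
    hold after applying [F], which is injective on packed arrows. *)
Lemma fully_faithful_isomorphism (C D : Category) (F : Functor C D) :
  Full F -> Faithful F -> bijective_on_objects F -> IsIsomorphism F.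
Proof.
intros Hfull Hfaith [Hinj Hsurj].
pose (s := fun y =>
  proj1_sig (constructive_indefinite_description _ (Hsurj y))).
assert (sK : forall y, F (s y) = y).
{ intros y. exact (proj2_sig (constructive_indefinite_description _ (Hsurj y))). }
pose (Gm := fun (x y : D) (g : hom x y) =>
  proj1_sig (constructive_indefinite_description _
    (full_mkarr_surj Hfull g (sK x) (sK y)))).
assert (GmK : forall (x y : D) (g : hom x y),
  mkarr (fmor F (Gm x y g)) = mkarr g).
{ intros x y g. exact (proj2_sig (constructive_indefinite_description _
    (full_mkarr_surj Hfull g (sK x) (sK y)))). }
clearbody Gm.
assert (Gm_id : forall x, Gm x x (id x) = id (s x)).
{ intros x. apply mkarr_inj, (faithful_mkarr_inj Hfaith Hinj).
  now rewrite GmK, fmor_id, sK. }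
assert (Gm_comp : forall (x y z : D) (g : hom y z) (f : hom x y),
  Gm x z (g ∘ f) = Gm y z g ∘ Gm x y f).
{ intros x y z g f. apply mkarr_inj, (faithful_mkarr_inj Hfaith Hinj).
  rewrite GmK, fmor_comp. apply mkarr_comp; symmetry; apply GmK. }
exists (@MkFunctor D C s Gm Gm_id Gm_comp). split; apply functor_eq; simpl.
(* After applying [F], the left inverse law becomes [GmK] at [fmor F f]. *)
- intros x y f. apply (faithful_mkarr_inj Hfaith Hinj), GmK.
- intros x y g. apply GmK.
Qed.

Section FirstIsomorphism.
Variables (G H : Groupoid) (F : Functor G H).
Hypothesis F_inj : injective_on_objects F.

Lemma nequiv_Ker (x y : G) (f g : hom x y) :
  nequiv (Ker F_inj) f g <-> fmor F f = fmor F g.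
Proof using Type.
split.
- intros (b & a & Hb & Ha & ->). rewrite !fmor_comp.
  rewrite (is_identity_eq Hb), (is_identity_eq Ha).
  now rewrite comp_id_l, comp_id_r.
(* The left factor [g ∘ inv f] alone carries [f] to [g]. *)
- intros E. exists (g ∘ inv f), (id x). repeat split.
  + simpl. rewrite fmor_comp, fmor_inv, E, inv_r. constructor.
  + apply nmem_id.
  + now rewrite comp_id_r, <- comp_assoc, inv_l, comp_id_r.
Qed.

(** Independence of the chosen representative: this makes evaluation of [F] on classes
    functorial. *)
Lemma fmor_repr_Ker (x y : G) (f : hom x y) :
  fmor F (repr (cls (@nequiv _ (Ker F_inj) x y) f)) = fmor F f.
Proof using Type.
apply nequiv_Ker, (repr_cls (@nequiv_equiv _ (Ker F_inj) x y)).
Qed.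

Definition Ker_induced : Functor (Quotient (Ker F_inj)) H.
Proof using G H F F_inj.
refine (@MkFunctor (Quotient (Ker F_inj)) H (fob F)
  (fun x y q => fmor F (repr q)) _ _).
- intros x. simpl. rewrite fmor_repr_Ker. apply fmor_id.
- intros x y z g f. simpl. unfold quo_comp. rewrite fmor_repr_Ker.
  apply fmor_comp.
Defined.

Lemma Ker_induced_toQuotient : fcomp Ker_induced (toQuotient (Ker F_inj)) = F.
Proof using Type.
apply functor_eq. intros x y f. simpl. now rewrite fmor_repr_Ker.
Qed.

Lemma Ker_induced_isomorphism :
  Full F -> surjective_on_objects F -> IsIsomorphism Ker_induced.
Proof using Type.
intros Hfull Hsurj. apply fully_faithful_isomorphism.
- intros x y g. destruct (Hfull x y g) as [f <-].
  exists (fmor (toQuotient (Ker F_inj)) f). apply fmor_repr_Ker.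
- intros x y f g E. rewrite <- (cls_repr f), <- (cls_repr g).
  apply (cls_eq (@nequiv_equiv _ (Ker F_inj) x y)), nequiv_Ker, E.
- exact (conj F_inj Hsurj).
Qed.

End FirstIsomorphism.

(** A zigzag joining preimages of two objects is mapped by [F] to a zigzag joining the objects. *)
Lemma connected_surjective_on_objects (C D : Category) (F : Functor C D) :
  surjective_on_objects F -> Connected C -> Connected D.
Proof.
intros Hsurj [[x0] Hconn]. split; [exact (inhabits (F x0))|].
intros x y. destruct (Hsurj x) as [a <-], (Hsurj y) as [b <-].
induction (Hconn a b) as [a b [f]|a|a b _ IH|a b c _ IH1 _ IH2].
- apply Relation_Operators.rst_step. exact (inhabits (fmor F f)).
- apply Relation_Operators.rst_refl.
- now apply Relation_Operators.rst_sym.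
- eapply Relation_Operators.rst_trans; eassumption.
Qed.

Lemma Qgrading_effective (B : Category) :
  Connected B -> Effective (Qgrading B).
Proof.
intros HB.
assert (Hsurj : surjective_on_objects (toQ B)) by (intros x; now exists x).
split; [exact (connected_surjective_on_objects Hsurj HB)|split].
- split; [intros x y E; exact E|exact Hsurj].
(* The identity also extends [toQ B] along itself, so uniqueness identifies it with [Qmap (toQ B)],
   which is therefore full. *)
- assert (E : Qmap (toQ B) = fid (Q B)).
  { symmetry. apply Qmap_unique. now apply functor_eq. }
  simpl. rewrite E. intros x y g. now exists g.
Qed.

Theorem proposition4p3 (B : Category) (B_connected : Connected B) :
  Effective (Qgrading B) /\
  forall X : Grading B, Effective X ->
    exists Z : Functor (Q B) (gr_groupoid X),
      unique (IsGradingMap (X := Qgrading B) (Y := X)) Z /\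
      exists Z_inj : injective_on_objects Z,
      exists Zbar : Functor (Quotient (Ker Z_inj)) (gr_groupoid X),
        fcomp Zbar (toQuotient (Ker Z_inj)) = Z /\ IsIsomorphism Zbar.
Proof.
split; [now apply Qgrading_effective|].
intros X (_ & [X_inj X_surj] & X_full).
exists (Qmap X). split.
- split; [apply Qmap_toQ|]. intros Z HZ. symmetry. now apply Qmap_unique.
(* [Qmap X] and [X] have convertible object maps, so bijectivity on objects carries over
   unchanged. *)
- assert (Z_inj : injective_on_objects (Qmap X)) by exact X_inj.
  exists Z_inj, (Ker_induced Z_inj).
  split; [apply Ker_induced_toQuotient|].
  now apply Ker_induced_isomorphism.
Qed.
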